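(* Let $q$ be a prime power with $q\neq 2$. For every integer $k\ge 0$ there is an integer $\bar R_k=\bar R_k(q)$ such that for all integers $r\ge \bar R_k$, \[ \overline{\mathrm{ex}}_q(r,k)=\binom{r}{k}(q-1)^{r-k}. \]
   Context: $F_q$ is the finite field with $q$ elements. $\overline{\mathrm{ex}}_q(r,k)$ denotes the maximum number of distinct columns of a matrix over $F_q$ (with any number of rows) such that every column has exactly $k$ entries equal to $0$ and the matrix has rank at most $r$. *)

(* Defs.v *)
From mathcomp Require Import all_boot all_order all_algebra.
From mathcomp Require Import boolp.

Set Implicit Arguments.
Unset Strict Implicit.
Unset Printing Implicit Defensive.

Import GRing.Theory.

Definition zeros_per_column (F : finFieldType) (k m n : nat)
    (A : 'M[F]_(m, n)) : Prop :=
  forall j : 'I_n, #|[set i : 'I_m | A i j == 0%R]| = k.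

(* Repeated columns are allowed in A, but are counted only once. *)
Definition num_distinct_columns (F : finFieldType) (m n : nat)
    (A : 'M[F]_(m, n)) : nat :=
  #|[set col j A | j : 'I_n]|.

Definition ex_bar_attained (F : finFieldType) (r k N : nat) : Prop :=
  exists (m n : nat) (A : 'M[F]_(m, n)),
    [/\ zeros_per_column k A, \rank A <= r & num_distinct_columns A = N].

Lemma ex_bar_attained0 (F : finFieldType) (r k : nat) :
  exists N, `[< ex_bar_attained F r k N >].
Proof.
exists 0; apply/asboolP; exists 0, 0, 0%R; split; first by case.
  by rewrite mxrank0.
by apply/eqP; rewrite cards_eq0 -subset0; apply/subsetP=> x /imsetP[[]].
Qed.

Lemma num_distinct_columns_le (F : finFieldType) (m n : nat)
    (A : 'M[F]_(m, n)) : num_distinct_columns A <= #|F| ^ \rank A.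
Proof.
have -> : #|F| ^ \rank A = #|[set: 'cV[F]_(\rank A)]|.
  by rewrite cardsT card_mx muln1.
apply: leq_trans (leq_imset_card (mulmx (col_base A)) _).
apply/subset_leq_card/subsetP=> _ /imsetP[j _ ->].
apply/imsetP; exists (col j (row_base A)); first by rewrite inE.
by rewrite !colE mulmxA mulmx_base.
Qed.

Lemma ex_bar_bounded (F : finFieldType) (r k N : nat) :
  `[< ex_bar_attained F r k N >] -> N <= #|F| ^ r.
Proof.
move=> /asboolP[m [n [A [_ rkA <-]]]].
apply: leq_trans (num_distinct_columns_le A) _.
by rewrite leq_pexp2l //; apply/card_gt0P; exists 0%R.
Qed.

(* The maximum exists because rank at most r forces at most #|F| ^ r distinct
   columns, whatever the number of rows. *)
Definition ex_bar (F : finFieldType) (r k : nat) : nat :=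
  ex_maxn (ex_bar_attained0 F r k) (@ex_bar_bounded F r k).

(* Main.v *)
Require Import Defs.
From mathcomp Require Import all_boot all_order all_algebra.
From mathcomp Require Import boolp zify.

(* Suppose first that A has at least r rows, and pick r of them spanning all
   the others: a column is then a vector v of r coordinates, the other rows
   being linear functionals of v. Among the 'C(r, k) (q-1)^(r-k) vectors with
   exactly k zero coordinates, those in the set L where some functional vanishes
   are not columns; in exchange, the set G of columns with fewer than k zero
   coordinates may occur. Turning a v in G into an element of L by setting
   further coordinates to zero is possible in about r ways, whereas an element of
   L arises from a number of v's bounded in terms of q and k only, so that
   |G| <= |L| for large r. Keeping a functional zero on the new vector is
   automatic when every functional involves at most one coordinate; otherwise one
   readjusts two coordinates involved in the same functional, keeping them
   nonzero, which is where q > 2 is used. With fewer than r rows, all vectors with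
   k zero entries are too few already. *)

Set Implicit Arguments.
Unset Strict Implicit.
Unset Printing Implicit Defensive.

Import GRing.Theory.

(** * Finite sets: intermediate subsets and double counting *)

Lemma exists_subset_card (T : finType) (Z U : {set T}) (n : nat) :
    Z \subset U -> #|Z| <= n <= #|U| ->
  exists2 S : {set T}, Z \subset S /\ S \subset U & #|S| = n.
Proof.
move=> ZU /andP[Zn nU].
have : 0 < #|[set A : {set T} | A \subset U :\: Z & #|A| == n - #|Z|]|.
  by rewrite cards_draws bin_gt0 cardsDS // leq_sub2r.
case/card_gt0P=> A; rewrite inE subsetD => /andP[/andP[AU AZ] /eqP cA].
exists (Z :|: A); first by rewrite subsetUl subUset ZU AU.
by rewrite cardsU disjoint_setI0 1?disjoint_sym // cards0 subn0 cA subnKC.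
Qed.

(** Fix one [n]-element set [S] between [Z] and [U]: adding to it each of the [#|U| - n] elements of
    [U :\: S] gives distinct sets. *)
Lemma card_supersets_ge (T : finType) (Z U : {set T}) (n : nat) :
    Z \subset U -> #|Z| <= n ->
  #|U| - n <= #|[set S : {set T} | [&& Z \subset S, S \subset U & #|S| == n.+1]]|.
Proof.
move=> ZU Zn; have [nU|/ltnW] := leqP n #|U|; last by rewrite -subn_eq0 => /eqP->.
have [S [ZS SU] cS] : exists2 S : {set T}, Z \subset S /\ S \subset U & #|S| = n.
  by apply: exists_subset_card => //; rewrite Zn.
have <- : #|[set x |: S | x in U :\: S]| = #|U| - n.
  rewrite card_in_imset ?cardsDS ?cS // => x y.
  rewrite !inE => /andP[xS _] /andP[_ _] eqS.
  by have := setU11 x S; rewrite eqS !inE (negPf xS) orbF => /eqP.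
apply/subset_leq_card/subsetP=> A /imsetP[x /setDP[xU xS] ->]; rewrite inE.
by rewrite cardsU1 xS cS eqxx andbT subUset sub1set xU SU (subset_trans ZS) ?subsetUr.
Qed.

Lemma leq_card_double_count (T : finType) (G L : {set T}) (R : rel T) (b : nat) :
    0 < b ->
    (forall x, x \in G -> b <= #|[set y in L | R x y]|) ->
    (forall y, y \in L -> #|[set x | R x y]| <= b) ->
  #|G| <= #|L|.
Proof.
move=> b0 GR LR; rewrite -(leq_pmul2r b0) -!sum_nat_const.
apply: (leq_trans (leq_sum _ GR)); apply: (leq_trans _ (leq_sum _ LR)).
under eq_bigr do rewrite -sum1dep_card big_mkcondr /=.
rewrite exchange_big /=; apply: leq_sum => y _.
rewrite -big_mkcondr sum1dep_card; apply/subset_leq_card/subsetP=> x.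
by rewrite !inE => /andP[].
Qed.

(** * Vectors counted by their zero coordinates *)

Section ZeroPatterns.

Variables (F : finFieldType) (J : finType).
Implicit Type v : {ffun J -> F}.

Definition zeros v : {set J} := [set j | v j == 0%R].

Lemma card_zeros (k : nat) :
  #|[set v | #|zeros v| == k]| = 'C(#|J|, k) * (#|F| - 1) ^ (#|J| - k).
Proof.
rewrite -sum1dep_card (partition_big zeros (fun T => #|T| == k)) //=.
under eq_bigr => T /eqP cT.
  under eq_bigl => v.
    rewrite (_ : _ && _ = (v \in pffun_on 0%R (~: T) (predC1 0%R))); first over.
    apply/andP/pffun_onP => [[_ /eqP<-]|[supp nz]].
      split; first by apply/subsetP=> j; rewrite !inE.
      by move=> _ /imageP[j jT ->]; move: jT; rewrite !inE.
    suff -> : zeros v = T by rewrite cT.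
    apply/setP=> j; rewrite inE; apply/idP/idP.
      by apply: contraLR => jT; apply: (nz); apply: image_f; rewrite inE.
    by apply: contraLR => vj; have := subsetP supp j; rewrite !inE; apply.
  rewrite sum1_card card_pffun_on cardC1 cardsCs setCK cT -subn1.
  over.
by rewrite sum_nat_cond_const card_draws.
Qed.

Definition agree_off (U : {set J}) : rel {ffun J -> F} :=
  fun v w => [forall j, (j \in U) || (v j == w j)].

Lemma card_agree_off (U : {set J}) w : #|[set v | agree_off U v w]| <= #|F| ^ #|U|.
Proof.
(* [h] erases the coordinates outside [U]. It is injective on the vectors counted, since [w]
   prescribes those coordinates. *)
pose h v : {ffun J -> F} := [ffun j => if j \in U then v j else 0%R].
rewrite -(@card_pffun_on _ _ 0%R (mem U) predT).
rewrite -(@card_in_imset _ _ h); first last.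
  move=> u v; rewrite !inE => /forallP uw /forallP vw /ffunP e; apply/ffunP=> j.
  have := e j; rewrite !ffunE; have := uw j; have := vw j.
  by case: (j \in U) => //= /eqP-> /eqP->.
apply/subset_leq_card/subsetP=> _ /imsetP[v _ ->]; apply/pffun_onP; split=> //.
by apply/subsetP=> j; rewrite inE ffunE; case: ifP; rewrite ?eqxx.
Qed.

(* D holds the coordinates that may be readjusted when v is moved into L. *)
Lemma card_leq_of_repair (D : {set J}) (G L : {set {ffun J -> F}}) (k : nat) :
    #|D| <= 2 -> #|F| ^ k.+2 + k.+2 <= #|J| ->
    (forall v, v \in G -> #|zeros v| < k) ->
    (forall v, v \in L -> #|zeros v| = k) ->
    (forall v (T : {set J}), v \in G -> #|T| = k ->
       zeros v :\: D \subset T -> T \subset ~: D ->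
       exists2 w, w \in L & zeros w = T /\ agree_off (T :|: D) v w) ->
  #|G| <= #|L|.
Proof.
move=> D2 Jbig Gk Lk rep; have F0 : 0 < #|F| by apply/card_gt0P; exists 0%R.
(* Given [w], only the entries of [v] on [zeros w :|: D] are free. These are at most [k + 2]
   coordinates, whence [b]. *)
pose R v w := agree_off (zeros w :|: D) v w.
apply: (leq_card_double_count (R := R) (b := #|F| ^ k.+2)).
- by rewrite expn_gt0 F0.
- move=> v vG; have vk := Gk v vG; have k0 : 0 < k by lia.
  have sD : zeros v :\: D \subset ~: D by rewrite setDE subsetIr.
  have cD : #|zeros v :\: D| <= k.-1.
    by have := subset_leq_card (subsetDl (zeros v) D); lia.
  have := card_supersets_ge sD cD; rewrite prednK // => cT.
  have cD' := cardsC D.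
  apply: (leq_trans (_ : _ <= #|~: D| - k.-1)); first by lia.
  (* Different sets [T] give different vectors [w], because [zeros w = T]. *)
  apply: (leq_trans cT); apply: leq_trans (leq_imset_card zeros _).
  apply/subset_leq_card/subsetP=> T; rewrite inE => /and3P[ZT TD /eqP cT'].
  have [w wL [zw ag]] := rep v T vG cT' ZT TD.
  by apply/imsetP; exists w; rewrite // inE wL /R zw.
move=> w wL; apply: (leq_trans (card_agree_off _ _)); rewrite leq_pexp2l //.
by rewrite (leq_trans (leq_card_setU _ _)) // (Lk w wL) -addn2 leq_add2l.
Qed.

(** Solving for [y] gives a nonzero value unless [x = - c / a], so [x] has just two values to avoid,
    0 and this one. *)
Lemma solve_nonzero (a b c : F) : 2 < #|F| -> a != 0%R -> b != 0%R ->
  exists x y : F, [/\ x != 0, y != 0 & a * x + b * y + c = 0]%R.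
Proof.
move=> F2 a0 b0.
have : 0 < #|~: [set 0; - c / a]%R|.
  have cardF : #|[set 0; - c / a]%R| + #|~: [set 0; - c / a]%R| = #|F| := cardsC _.
  by move: F2; rewrite -cardF cards2; case: #|_|; case: (_ != _).
case/card_gt0P=> x; rewrite !inE negb_or => /andP[x0 xca].
exists x, (- (a * x + c) / b)%R; split=> //.
  rewrite mulf_neq0 ?invr_eq0 // oppr_eq0; apply: contra xca.
  by rewrite addr_eq0 => /eqP<-; rewrite mulrC mulKf.
by rewrite [(b * _)%R]mulrC divfK // addrAC subrr.
Qed.

(** [J] stands for the chosen spanning rows, [E] for the other rows, and [c e] for the coefficients
    of row [e]. The left side thus counts all candidate columns. *)
Lemma card_zeros_extra_rows (E : finType) (c : E -> J -> F) (k : nat) :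
    2 < #|F| -> #|F| ^ k.+2 + k.+2 <= #|J| ->
  #|[set v | #|zeros v| + #|[set e | (\sum_j c e j * v j)%R == 0%R]| == k]|
    <= #|[set v | #|zeros v| == k]|.
Proof.
move=> F2 Jbig; pose ev e v := (\sum_j c e j * v j)%R.
set X := [set v | _ + _ == k]; set K := [set v | _ == k].
pose z v := #|[set e | ev e v == 0%R]|.
have XE v : (v \in X) = (#|zeros v| + z v == k) by rewrite inE.
have z_gt0 v : 0 < z v -> exists e, ev e v == 0%R.
  by case/card_gt0P=> e; rewrite inE; exists e.
pose G := [set v in X | #|zeros v| < k].
pose L := [set v in K | [exists e, ev e v == 0%R]].
have GL : #|G| <= #|L|; last first.
  (* A vector of [X] that already has [k] zeros on [J] leaves none for the functionals, so it lies
     outside [L]. *)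
  have XGK : X \subset G :|: (K :\: L).
    apply/subsetP=> v vX; rewrite in_setU in_setD !in_set; move: vX; rewrite XE => /eqP vX.
    rewrite vX eqxx /=; case: ltnP => //= kv.
    have vk : #|zeros v| = k by lia.
    rewrite vk eqxx andbT /=; apply/existsPn=> e; apply/negP=> ve.
    suff : 0 < z v by lia.
    by apply/card_gt0P; exists e; rewrite inE.
  have LK : L \subset K by apply/subsetP=> v /setIdP[].
  apply: (leq_trans (subset_leq_card XGK)).
  apply: (leq_trans (leq_card_setU _ _)); rewrite (cardsDS LK).
  by have := subset_leq_card LK; lia.
have Gk v : v \in G -> #|zeros v| < k by case/setIdP.
have Lk v : v \in L -> #|zeros v| = k by case/setIdP; rewrite inE => /eqP.
case: (pselect (exists e a b, [/\ a != b, c e a != 0%R & c e b != 0%R])) => [|no2].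
  case=> e [a [b [ab ca cb]]].
  apply: (@card_leq_of_repair [set a; b] _ _ k) => //; first by rewrite cards2; case: (_ != _).
  move=> v T vG cT zT TD.
  have [aT bT] : a \notin T /\ b \notin T.
    by split; apply/negP=> /(subsetP TD); rewrite !inE eqxx ?orbT.
  (* [g] is the contribution to [ev e w] of the coordinates other than [a] and [b]. The values [x]
     and [y] there then make [e] vanish on [w], whatever its value on [v]. *)
  pose g := (\sum_(j | (j != a) && (j != b)) c e j * (if j \in T then 0 else v j))%R.
  have [x [y [x0 y0 xyg]]] := solve_nonzero g F2 ca cb.
  pose w : {ffun J -> F} := [ffun j => if j == a then x else if j == b then y
                             else if j \in T then 0%R else v j].
  have zw : zeros w = T.
    apply/setP=> j; rewrite inE ffunE.
    case: (eqVneq j a) => [->|ja]; first by rewrite (negPf x0) (negPf aT).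
    case: (eqVneq j b) => [->|jb]; first by rewrite (negPf y0) (negPf bT).
    case: ifP => [_|/negP jT]; first exact: eqxx.
    apply/negP=> vj; apply/jT/(subsetP zT).
    by rewrite !inE (negPf ja) (negPf jb) vj.
  exists w; last first.
    split=> //; apply/forallP=> j; rewrite !inE ffunE.
    by case: (j \in T) (j == a) (j == b) => [] [] [] /=.
  rewrite !in_set zw cT eqxx; apply/existsP; exists e.
  have ba : b != a by rewrite eq_sym.
  rewrite /ev (bigD1 a) // (bigD1 b) //= !ffunE !eqxx (negPf ba) addrA.
  apply/eqP; rewrite -[RHS]xyg; congr (_ + _)%R.
  by apply: eq_bigr => j /andP[/negPf ja /negPf jb]; rewrite ffunE ja jb.
(* Each functional now has at most one nonzero coefficient, so when it vanishes at [v] every single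
   term is zero, and zeroing further coordinates preserves this. *)
have ev0 e v : ev e v = 0%R -> forall j, (c e j * v j)%R = 0%R.
  move=> evv j; have [->|cj] := eqVneq (c e j) 0%R; first by rewrite mul0r.
  move: evv; rewrite /ev (bigD1 j) //= big1 ?addr0 // => i ij.
  have [->|ci] := eqVneq (c e i) 0%R; first by rewrite mul0r.
  by case: no2; exists e, i, j.
apply: (@card_leq_of_repair set0 _ _ k) => //; first by rewrite cards0.
move=> v T vG cT; rewrite setD0 setU0 => zT _.
pose w : {ffun J -> F} := [ffun j => if j \in T then 0%R else v j].
have zw : zeros w = T.
  apply/setP=> j; rewrite inE ffunE; case: ifP => [_|/negP jT]; first exact: eqxx.
  by apply/negP=> vj; apply/jT/(subsetP zT); rewrite inE.
exists w; last by split=> //; apply/forallP=> j; rewrite ffunE; case: (j \in T) => /=.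
rewrite !in_set zw cT eqxx.
(* [v] has [k] zeros in all but fewer than [k] on [J], so some functional vanishes. *)
have [e /eqP ve] : exists e, ev e v == 0%R.
  have vk := Gk v vG; have [+ _] := setIdP vG; rewrite XE => /eqP vX; apply: z_gt0; lia.
apply/existsP; exists e; apply/eqP/big1 => j _; rewrite ffunE.
by case: ifP; rewrite ?mulr0 // (ev0 e v ve).
Qed.

End ZeroPatterns.

(** * Distinct columns of matrices: the lower and the upper bound *)

Lemma ex_bar_attained_bin (F : finFieldType) (r k : nat) :
  ex_bar_attained F r k ('C(r, k) * (#|F| - 1) ^ (r - k)).
Proof.
pose K := [set v : {ffun 'I_r -> F} | #|zeros v| == k].
(* The columns are all the vectors with exactly [k] zeros; having [r] rows bounds the rank. *)
pose A : 'M[F]_(r, #|K|) := (\matrix_(i, j) (enum_val (A := K) j : {ffun _ -> _}) i)%R.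
exists r, #|K|, A; split; last 1 first.
- rewrite /num_distinct_columns card_imset ?card_ord => [|j j' /colP eqA].
    by rewrite card_zeros card_ord.
  apply/enum_val_inj/ffunP=> i; by have := eqA i; rewrite !mxE.
- move=> j; have := enum_valP j; rewrite inE => /eqP <-.
  by apply: eq_card => i; rewrite !inE mxE.
exact: rank_leq_row.
Qed.

Lemma leq_bin_expn (a k m r : nat) : 0 < a -> m <= r ->
  'C(m, k) * a ^ (m - k) <= 'C(r, k) * a ^ (r - k).
Proof.
by move=> a0 mr; rewrite leq_mul ?leq_bin2l // leq_pexp2l // leq_sub2r.
Qed.

Lemma card_sig_set (T : finType) (P Q : pred T) :
  #|[set x : {x | P x} | Q (val x)]| = #|[set x | P x & Q x]|.
Proof.
rewrite -(card_imset _ val_inj); apply: eq_card => x; rewrite inE.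
apply/imsetP/andP => [[[y Py]] | [Px Qx]]; first by rewrite inE => Qy ->.
by exists (Sub x Px); rewrite ?inE.
Qed.

Lemma num_distinct_columns_restrict (F : finFieldType) (m n : nat)
    (A : 'M[F]_(m, n)) (J : finType) (g : J -> 'I_m) (Y : {set {ffun J -> F}}) :
    (forall j, [ffun s => A (g s) j] \in Y) ->
    (forall j j', (forall s, A (g s) j = A (g s) j') -> col j A = col j' A) ->
  num_distinct_columns A <= #|Y|.
Proof.
move=> AY inj; pose h (w : 'cV[F]_m) : {ffun J -> F} := [ffun s => w (g s) 0%R].
rewrite /num_distinct_columns -(@card_in_imset _ _ h); first last.
  move=> _ _ /imsetP[j _ ->] /imsetP[j' _ ->] /ffunP eqh.
  by apply: inj => s; have := eqh s; rewrite !ffunE !mxE.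
apply/subset_leq_card/subsetP=> _ /imsetP[_ /imsetP[j _ ->] ->].
suff -> : h (col j A) = [ffun s => A (g s) j] by [].
by apply/ffunP=> s; rewrite !ffunE mxE.
Qed.

Lemma exists_spanning_rows (F : fieldType) (m n r : nat) (A : 'M[F]_(m, n)) :
    \rank A <= r <= m ->
  exists2 S : {set 'I_m}, #|S| = r &
    exists c : 'I_m -> {i | i \in S} -> F,
      forall i j, A i j = (\sum_s c i s * A (val s) j)%R.
Proof.
move=> rkA; pose g := maxrankfun A.
(* A row basis is padded with arbitrary rows to exactly [r] rows. *)
have [S [gS _] cS] : exists2 S : {set 'I_m},
    [set g t | t : 'I_(\rank A)] \subset S /\ S \subset setT & #|S| = r.
  apply: exists_subset_card; first exact: subsetT.
  by rewrite card_imset ?cardsT ?card_ord //; apply: maxrankfun_inj.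
exists S => //.
have gP t : g t \in S by apply: (subsetP gS); apply: imset_f.
pose p t : {i | i \in S} := exist _ (g t) (gP t).
have /submxP[D AD] : (A <= rowsub g A)%MS by rewrite eq_maxrowsub.
(* For a padding row [s] the sum is empty, so its coefficient is 0. *)
exists (fun i s => \sum_(t | p t == s) D i t)%R => i j.
rewrite {1}AD mxE (partition_big p predT) //=; apply: eq_bigr => s _.
by rewrite big_distrl /=; apply: eq_bigr => t /eqP <-; rewrite mxE.
Qed.

Lemma num_distinct_columns_leq (F : finFieldType) (m n r k : nat)
    (A : 'M[F]_(m, n)) :
    2 < #|F| -> #|F| ^ k.+2 + k.+2 <= r ->
    zeros_per_column k A -> \rank A <= r ->
  num_distinct_columns A <= 'C(r, k) * (#|F| - 1) ^ (r - k).
Proof.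
move=> F2 rbig Ak rkA; have [mr|/ltnW rm] := leqP m r.
  apply: leq_trans (leq_bin_expn k _ mr); last by lia.
  rewrite -[in leqRHS](card_ord m) -card_zeros.
  apply: (num_distinct_columns_restrict (g := id)) => [j|j j' eqA].
    by rewrite inE -(Ak j); apply/eqP/eq_card=> i; rewrite !inE ffunE.
  by apply/colP=> i; rewrite !mxE.
have [|S cS [c cE]] := @exists_spanning_rows F m n r A; first by rewrite rkA.
pose J : finType := {i | i \in S}; pose E : finType := {i | i \notin S}.
have cJ : #|J| = r by rewrite card_sig -cS; apply: eq_card.
rewrite -cJ -card_zeros.
apply: leq_trans (card_zeros_extra_rows (fun e : E => c (val e)) _ _); rewrite ?cJ //.
apply: (num_distinct_columns_restrict (g := val)) => [j|j j' eqA]; last first.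
  by apply/colP=> i; rewrite !mxE !cE; apply: eq_bigr => s _; rewrite eqA.
(* The [k] zeros of column [j] are split between the rows in [S] and the remaining ones. *)
rewrite inE -(Ak j) -(cardsID S [set i | A i j == 0%R]); apply/eqP; congr (_ + _).
  rewrite (_ : zeros _ = [set s : J | A (val s) j == 0%R]).
    rewrite (card_sig_set (mem S) (fun i => A i j == 0%R)).
    by apply: eq_card => i; rewrite !inE andbC.
  by apply/setP=> s; rewrite !inE ffunE.
rewrite (_ : [set e | _] = [set e : E | A (val e) j == 0%R]).
  rewrite (card_sig_set (fun i => i \notin S) (fun i => A i j == 0%R)).
  by apply: eq_card => i; rewrite !inE.
apply/setP=> e; rewrite !inE cE; congr (_ == _).
by apply: eq_bigr => s _; rewrite ffunE.
Qed.

Theorem theorem2 (q : nat) (F : finFieldType) (card_F : #|F| = q)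
    (q_neq2 : q <> 2) (k : nat) :
  exists R : nat, forall r : nat, R <= r ->
    ex_bar F r k = 'C(r, k) * (q - 1) ^ (r - k).
Proof.
have F2 : 2 < #|F|.
  have F1 : 1 < #|F| := card_finNzRing_gt1 F.
  by rewrite ltn_neqAle F1 card_F eq_sym andbT; apply/eqP.
exists (#|F| ^ k.+2 + k.+2) => r rbig; rewrite -card_F /ex_bar.
case: ex_maxnP => N /asboolP[m [n [A [Ak rkA <-]]]] maxA.
apply/eqP; rewrite eqn_leq num_distinct_columns_leq //.
by apply/maxA/asboolP/ex_bar_attained_bin.
Qed.
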